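(* Let $N\ge1$, let $\mathbf w^{\mathrm{start}},\mathbf w^{\mathrm{end}}\in\mathbb R^N$ be weight vectors (positive components summing to $1$), and let $f=2^d$ for some integer $d\ge 1$. Start from the list $(\mathbf w^{\mathrm{start}},\mathbf w^{\mathrm{end}})$ and perform $d$ levels of the following operation: between each consecutive pair $(\mathbf a,\mathbf b)$ of the current list, insert the (AM+GM)/normalise midpoint $M(\mathbf a,\mathbf b)$. Then the resulting list of $2^d+1$ points is exactly the full $f$-step SLERP trajectory $\mathbf w(k/f)$, $k=0,1,\dots,f$, i.e. its $k$-th entry has components $$w_i(k/f)=\left[\frac{\sin((1-\frac kf)\Omega)}{\sin\Omega}\sqrt{w_i^{\mathrm{start}}}+\frac{\sin(\frac kf\Omega)}{\sin\Omega}\sqrt{w_i^{\mathrm{end}}}\right]^2,\qquad \Omega=\arccos\left(\sum_j\sqrt{w_j^{\mathrm{start}}w_j^{\mathrm{end}}}\right).$$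
   Context: For weight vectors $\mathbf a,\mathbf b$ the (AM+GM)/normalise midpoint $M(\mathbf a,\mathbf b)$ is the weight vector with components $$M(\mathbf a,\mathbf b)_i=\frac{\frac{a_i+b_i}{2}+\sqrt{a_ib_i}}{\sum_j\left(\frac{a_j+b_j}{2}+\sqrt{a_jb_j}\right)}.$$ When $\mathbf w^{\mathrm{start}}=\mathbf w^{\mathrm{end}}$ ($\Omega=0$) the SLERP trajectory is understood as the constant trajectory. *)

(* Defs.v *)
(* MathComp-Analysis; real numbers are an arbitrary [R : realType]. *)
From mathcomp Require Import all_boot all_order all_algebra.
From mathcomp Require Import reals trigo.

Set Implicit Arguments.
Unset Strict Implicit.
Unset Printing Implicit Defensive.

Import Order.TTheory GRing.Theory Num.Theory.

Local Open Scope ring_scope.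

Definition weight_vector (R : realType) (N : nat) (w : 'rV[R]_N) : Prop :=
  (forall i, 0 < w 0 i) /\ \sum_i w 0 i = 1.

Definition am_plus_gm (R : realType) (x y : R) : R :=
  (x + y) / 2 + Num.sqrt (x * y).

Definition midpoint (R : realType) (N : nat) (a b : 'rV[R]_N) : 'rV[R]_N :=
  \row_i (am_plus_gm (a 0 i) (b 0 i) / \sum_j am_plus_gm (a 0 j) (b 0 j)).

(* [:: x0; x1; ...; xn] |-> [:: x0; m x0 x1; x1; m x1 x2; ...; xn] *)
Fixpoint insert_between (T : Type) (m : T -> T -> T) (s : seq T) : seq T :=
  match s with
  | a :: ((b :: _) as s') => a :: m a b :: insert_between m s'
  | _ => s
  end.

Definition slerp_angle (R : realType) (N : nat) (u v : 'rV[R]_N) : R :=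
  acos (\sum_j Num.sqrt (u 0 j * v 0 j)).

(* The coefficients sin((1 - t) W) / sin W and sin(t W) / sin W are undefined
   when the endpoints coincide (angle W = 0); there the trajectory is the
   constant one by convention. *)
Definition slerp (R : realType) (N : nat) (u v : 'rV[R]_N) (t : R) :
    'rV[R]_N :=
  if u == v then u else
  let W := slerp_angle u v in
  \row_i (sin ((1 - t) * W) / sin W * Num.sqrt (u 0 i)
          + sin (t * W) / sin W * Num.sqrt (v 0 i)) ^+ 2.

(* Main.v *)
(* Entrywise square roots map weight vectors to unit vectors, and [slerp] is
   the entrywise square of the great-circle arc r(t) between them.  On nonnegative
   entries (x^2 + y^2)/2 + sqrt (x^2 y^2) = (x + y)^2 / 2, so the midpoint of
   r(s)^2 and r(t)^2 is the normalised square of r(s) + r(t), which equals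
   2 cos ((s - t) W / 2) r((s + t) / 2).  Since r((s + t) / 2) is a unit vector,
   normalising removes exactly the scalar factor. *)
Require Import Defs.
From mathcomp Require Import all_boot all_order all_algebra.
From mathcomp Require Import reals trigo.
From mathcomp Require Import ring lra.
Import Order.TTheory GRing.Theory Num.Theory.
Local Open Scope ring_scope.

(** Reduces one level of insertion to identities between indexed points. In the induction, dropping
    the first point shifts [F] by one index and [G] by two. *)
Lemma insert_between_mkseq (T : Type) (m : T -> T -> T) (F G : nat -> T)
    (n : nat) :
  (forall k, (k <= n)%N -> G k.*2 = F k) ->
  (forall k, (k < n)%N -> G k.*2.+1 = m (F k) (F k.+1)) ->
  insert_between m (mkseq F n.+1) = mkseq G n.*2.+1.
Proof.
have mkseqS (H : nat -> T) k : mkseq H k.+1 = H 0 :: mkseq (H \o succn) k.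
  by rewrite /mkseq /= (iotaDl 1 0) -map_comp.
elim: n F G => [|n IHn] F G Geven Godd; first by rewrite /mkseq /= -Geven.
rewrite doubleS !mkseqS.
have /= -> := Geven 0 isT; have /= -> := Godd 0 isT.
rewrite -[RHS]/(F 0 :: m (F 0) (F 1) :: _).
rewrite -(mkseqS (G \o succn \o succn)) -(IHn (F \o succn)) ?mkseqS //.
  by move=> k k_le; rewrite /= -doubleS Geven.
by move=> k k_lt; rewrite /= -doubleS Godd.
Qed.

Lemma am_plus_gm_sqr (R : realType) (x y : R) : 0 <= x -> 0 <= y ->
  am_plus_gm (x ^+ 2) (y ^+ 2) = (x + y) ^+ 2 / 2.
Proof.
move=> x_ge0 y_ge0.
rewrite /am_plus_gm -exprMn sqrtr_sqr ger0_norm ?mulr_ge0 //.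
by field.
Qed.

(** Each unnormalised entry is [c ^+ 2 / 2] times [x 0 i ^+ 2]; as [x] has norm 1, the normalising
    sum is that same factor, which cancels. *)
Lemma midpoint_sqr (R : realType) (N : nat) (a b x : 'rV[R]_N) (c : R) :
  (forall i, 0 <= a 0 i) -> (forall i, 0 <= b 0 i) ->
  (forall i, a 0 i + b 0 i = c * x 0 i) -> c != 0 ->
  \sum_i x 0 i ^+ 2 = 1 ->
  midpoint (\row_i a 0 i ^+ 2) (\row_i b 0 i ^+ 2) = \row_i x 0 i ^+ 2.
Proof.
move=> a_ge0 b_ge0 abE c_neq0 x_unit.
have amgmE i : am_plus_gm ((\row_i a 0 i ^+ 2) 0 i) ((\row_i b 0 i ^+ 2) 0 i)
    = c ^+ 2 / 2 * x 0 i ^+ 2.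
  by rewrite !mxE am_plus_gm_sqr // abE; field.
apply/rowP => i; rewrite [LHS]mxE amgmE.
under eq_bigr => j _ do rewrite amgmE.
by rewrite -mulr_sumr x_unit !mxE; field.
Qed.

(** Serves the constant trajectory, where the two endpoints coincide. *)
Lemma midpointxx (R : realType) (N : nat) (a : 'rV[R]_N) :
  weight_vector a -> midpoint a a = a.
Proof.
move=> [a_gt0 a_sum].
have amgmE i : am_plus_gm (a 0 i) (a 0 i) = 2 * a 0 i.
  rewrite /am_plus_gm -expr2 sqrtr_sqr ger0_norm ?ltW //.
  by field.
apply/rowP => i; rewrite mxE amgmE.
under eq_bigr => j _ do rewrite amgmE.
by rewrite -mulr_sumr a_sum; field.
Qed.

Section SlerpArc.
Variables (R : realType) (N : nat) (u v : 'rV[R]_N).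
Hypotheses (u_weight : weight_vector u) (v_weight : weight_vector v).

Let sqrt_sqr (w : 'rV[R]_N) i : weight_vector w -> Num.sqrt (w 0 i) ^+ 2 = w 0 i.
Proof. by case=> w_gt0 _; rewrite sqr_sqrtr ?ltW. Qed.

Let sqrtuv i : Num.sqrt (u 0 i * v 0 i) = Num.sqrt (u 0 i) * Num.sqrt (v 0 i).
Proof. by rewrite sqrtrM // ltW //; case: u_weight. Qed.

Lemma bhattacharyya_ge0 : 0 <= \sum_j Num.sqrt (u 0 j * v 0 j).
Proof. by apply: sumr_ge0 => j _; apply: sqrtr_ge0. Qed.

(* 2 - 2 p.q = |p - q|^2 for unit vectors p and q. *)
Lemma bhattacharyya_lt1 : u != v -> \sum_j Num.sqrt (u 0 j * v 0 j) < 1.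
Proof.
move=> u_neq_v; set S := \sum_j _.
have SE : \sum_j (Num.sqrt (u 0 j) - Num.sqrt (v 0 j)) ^+ 2 = 2 - 2 * S.
  have -> : 2 - 2 * S = \sum_j u 0 j + \sum_j v 0 j - 2 * S.
    by rewrite (proj2 u_weight) (proj2 v_weight).
  rewrite mulr_sumr -big_split -sumrB /=; apply: eq_bigr => j _.
  rewrite sqrtuv; have := sqrt_sqr _ j u_weight; have := sqrt_sqr _ j v_weight.
  by move: (Num.sqrt (u 0 j)) (Num.sqrt (v 0 j)) => p q <- <-; ring.
suff : 0 < 2 - 2 * S by lra.
rewrite -SE lt_def sumr_ge0 ?andbT; last by move=> j _; apply: sqr_ge0.
apply: contra u_neq_v => /eqP/psumr_eq0P eq0; apply/eqP/rowP => i.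
have /eqP := eq0 (fun j _ => sqr_ge0 _) i isT.
rewrite sqrf_eq0 subr_eq0 => /eqP sqrt_eq.
by rewrite -(sqrt_sqr _ i u_weight) sqrt_eq sqrt_sqr.
Qed.

Let W := slerp_angle u v.

(** The arc r(t) itself, before squaring: identities linear in the arc can be stated for it. *)
Definition slerp_arc (t : R) : 'rV[R]_N :=
  \row_i (sin ((1 - t) * W) / sin W * Num.sqrt (u 0 i)
          + sin (t * W) / sin W * Num.sqrt (v 0 i)).

Hypothesis u_neq_v : u != v.

Lemma slerpE t : slerp u v t = \row_i slerp_arc t 0 i ^+ 2.
Proof. by apply/rowP => i; rewrite /slerp (negPf u_neq_v) !mxE. Qed.

Let bhattacharyya_itv :
  -1 <= \sum_j Num.sqrt (u 0 j * v 0 j) <= 1.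
Proof. by have := bhattacharyya_ge0; have := bhattacharyya_lt1 u_neq_v; lra. Qed.

Lemma cos_slerp_angle :
  cos W = \sum_j Num.sqrt (u 0 j) * Num.sqrt (v 0 j).
Proof.
by rewrite /W /slerp_angle acosK //; apply: eq_bigr => j _; apply: sqrtuv.
Qed.

(** Strictness comes from [u != v]; with [W < pi] it makes [sin W] a legitimate divisor. *)
Lemma slerp_angle_gt0 : 0 < W.
Proof.
apply: acos_gt0; have := bhattacharyya_ge0.
by have := bhattacharyya_lt1 u_neq_v; lra.
Qed.

Lemma slerp_angle_ltpi : W < pi.
Proof.
apply: acos_ltpi; have := bhattacharyya_ge0.
by have := bhattacharyya_lt1 u_neq_v; lra.
Qed.

Lemma sin_slerp_angle_gt0 : 0 < sin W.
Proof. by rewrite sin_gt0_pi // slerp_angle_gt0 slerp_angle_ltpi. Qed.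

(** Both [(1 - t) * W] and [t * W] stay in [0, pi]. The sign matters because the geometric mean of
    two squares is the product of the roots only up to absolute value. *)
Lemma slerp_arc_ge0 t i : 0 <= t <= 1 -> 0 <= slerp_arc t 0 i.
Proof.
move=> t01; have W_gt0 := slerp_angle_gt0; have W_lt := slerp_angle_ltpi.
have sin_ge0 x : 0 <= x <= 1 -> 0 <= sin (x * W).
  by move=> x01; rewrite sin_ge0_pi //; nra.
have sW_gt0 := sin_slerp_angle_gt0.
rewrite mxE addr_ge0 // mulr_ge0 ?sqrtr_ge0 // divr_ge0 ?(ltW sW_gt0) ?sin_ge0 //.
lra.
Qed.

(** The square roots of [u] and [v] are unit vectors with inner product [cos W], so the claim
    becomes sin^2 A + sin^2 B + 2 sin A sin B cos (A + B) = sin^2 (A + B) with A + B = W. *)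
Lemma slerp_arc_unit t : \sum_i slerp_arc t 0 i ^+ 2 = 1.
Proof.
have sW_neq0 : sin W != 0 by rewrite gt_eqF // sin_slerp_angle_gt0.
set A := (1 - t) * W; set B := t * W.
have WE : W = A + B by rewrite /A /B; ring.
have -> : \sum_i slerp_arc t 0 i ^+ 2
    = (sin A / sin W) ^+ 2 * \sum_i u 0 i + (sin B / sin W) ^+ 2 * \sum_i v 0 i
      + 2 * (sin A / sin W) * (sin B / sin W) * cos W.
  rewrite cos_slerp_angle !mulr_sumr -!big_split; apply: eq_bigr => i _ /=.
  rewrite mxE -/A -/B.
  have := sqrt_sqr _ i u_weight; have := sqrt_sqr _ i v_weight.
  by move: (Num.sqrt (u 0 i)) (Num.sqrt (v 0 i)) => p q <- <-; ring.
rewrite (proj2 u_weight) (proj2 v_weight).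
have -> : (sin A / sin W) ^+ 2 * 1 + (sin B / sin W) ^+ 2 * 1
      + 2 * (sin A / sin W) * (sin B / sin W) * cos W
    = (sin A ^+ 2 + sin B ^+ 2 + 2 * sin A * sin B * cos W) / sin W ^+ 2.
  by field.
apply: (canLR (mulfK _)); first by rewrite expf_neq0.
rewrite mul1r WE sinD cosD.
have := cos2Dsin2 A; have := cos2Dsin2 B.
move: (sin A) (cos A) (sin B) (cos B) => sA cA sB cB eqB eqA.
(* Expanding first exposes the squared cosines to the next two rewrites. *)
have -> : (sA * cB + cA * sB) ^+ 2
    = sA ^+ 2 * cB ^+ 2 + cA ^+ 2 * sB ^+ 2 + 2 * sA * sB * cA * cB by ring.
have -> : cA ^+ 2 = 1 - sA ^+ 2 by rewrite -eqA addrK.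
have -> : cB ^+ 2 = 1 - sB ^+ 2 by rewrite -eqB addrK.
by ring.
Qed.

(** Sum-to-product for sines, at the centres [m * W] and [(1 - m) * W]: the half-difference [h] is
    the same up to sign, so both coefficients gain the factor [2 * cos h]. *)
Lemma slerp_arcD s t i :
  slerp_arc s 0 i + slerp_arc t 0 i
  = 2 * cos ((s - t) / 2 * W) * slerp_arc ((s + t) / 2) 0 i.
Proof.
have sinDB (m h : R) : sin (m + h) + sin (m - h) = 2 * cos h * sin m.
  by rewrite sinB sinD; ring.
set h := (s - t) / 2 * W; set m := (s + t) / 2.
have := sinDB (m * W) h; have := sinDB ((1 - m) * W) h.
have -> : (1 - m) * W + h = (1 - t) * W by rewrite /h /m; field.
have -> : (1 - m) * W - h = (1 - s) * W by rewrite /h /m; field.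
have -> : m * W + h = s * W by rewrite /h /m; field.
have -> : m * W - h = t * W by rewrite /h /m; field.
move=> eq1 eq2; rewrite !mxE.
transitivity ((sin ((1 - t) * W) + sin ((1 - s) * W)) / sin W * Num.sqrt (u 0 i)
    + (sin (s * W) + sin (t * W)) / sin W * Num.sqrt (v 0 i)); first by ring.
by rewrite eq1 eq2; ring.
Qed.

Lemma midpoint_slerp_neq s t : 0 <= s <= 1 -> 0 <= t <= 1 ->
  midpoint (slerp u v s) (slerp u v t) = slerp u v ((s + t) / 2).
Proof.
move=> s01 t01; rewrite !slerpE.
apply: (@midpoint_sqr _ _ _ _ _ (2 * cos ((s - t) / 2 * W))) => [i|i|i||].
- exact: slerp_arc_ge0.
- exact: slerp_arc_ge0.
- exact: slerp_arcD.
- have W_gt0 := slerp_angle_gt0; have W_lt := slerp_angle_ltpi.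
  (* Since |s - t| <= 1 and [W < pi], the angle lies strictly between -pi/2 and pi/2. *)
  rewrite mulf_neq0 ?pnatr_eq0 // gt_eqF // cos_gt0_pihalf //.
  by apply/andP; split; nra.
- exact: slerp_arc_unit.
Qed.

Lemma slerp0_neq : slerp u v 0 = u.
Proof.
apply/rowP => i; rewrite slerpE !mxE subr0 mul0r mul1r sin0 !mul0r addr0.
by rewrite divff ?mul1r ?sqrt_sqr // gt_eqF // sin_slerp_angle_gt0.
Qed.

Lemma slerp1_neq : slerp u v 1 = v.
Proof.
apply/rowP => i; rewrite slerpE !mxE subrr mul0r mul1r sin0 !mul0r add0r.
by rewrite divff ?mul1r ?sqrt_sqr // gt_eqF // sin_slerp_angle_gt0.
Qed.

End SlerpArc.

Lemma slerpxx (R : realType) (N : nat) (u : 'rV[R]_N) t : slerp u u t = u.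
Proof. by rewrite /slerp eqxx. Qed.

Lemma midpoint_slerp (R : realType) (N : nat) (u v : 'rV[R]_N) (s t : R) :
  weight_vector u -> weight_vector v -> 0 <= s <= 1 -> 0 <= t <= 1 ->
  midpoint (slerp u v s) (slerp u v t) = slerp u v ((s + t) / 2).
Proof.
have [<-|u_neq_v] := eqVneq u v; last by move=> *; apply: midpoint_slerp_neq.
by move=> u_weight *; rewrite !slerpxx midpointxx.
Qed.

Lemma slerp0 (R : realType) (N : nat) (u v : 'rV[R]_N) :
  weight_vector u -> weight_vector v -> slerp u v 0 = u.
Proof.
have [<-|u_neq_v] := eqVneq u v; first by rewrite slerpxx.
by move=> *; apply: slerp0_neq.
Qed.

Lemma slerp1 (R : realType) (N : nat) (u v : 'rV[R]_N) :
  weight_vector u -> weight_vector v -> slerp u v 1 = v.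
Proof.
have [<-|u_neq_v] := eqVneq u v; first by rewrite slerpxx.
by move=> *; apply: slerp1_neq.
Qed.

Theorem corollary3 (R : realType) (N : nat) (N_ge1 : (1 <= N)%N)
    (wstart wend : 'rV[R]_N)
    (wstart_weight : weight_vector wstart) (wend_weight : weight_vector wend)
    (d f : nat) (d_ge1 : (1 <= d)%N) (f_eq : f = (2 ^ d)%N) :
  iter d (insert_between (@midpoint R N)) [:: wstart; wend]
  = mkseq (fun k : nat => slerp wstart wend (k%:R / f%:R)) f.+1.
Proof.
(* The induction starts at level 0, where the pair of endpoints is the one-step trajectory. *)
rewrite {f}f_eq; elim: d {d_ge1} => [|d IHd].
  by rewrite /mkseq /= expn0 mul0r divr1 slerp0 // slerp1.
rewrite iterS IHd expnS mul2n.
have f_gt0 : 0 < (2 ^ d)%:R :> R by rewrite ltr0n expn_gt0.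
have f_neq0 : (2 ^ d)%:R != 0 :> R by rewrite gt_eqF.
have frac01 k : (k <= 2 ^ d)%N -> 0 <= (k%:R / (2 ^ d)%:R : R) <= 1.
  by move=> k_le; rewrite divr_ge0 ?ler0n //= ler_pdivrMr // mul1r ler_nat.
apply: insert_between_mkseq => k k_le.
  by congr slerp; rewrite -!muln2 !natrM; field.
(* The mean of k / 2^d and (k + 1) / 2^d is (2k + 1) / 2^(d+1), an odd point of the finer grid. *)
rewrite midpoint_slerp ?frac01 ?(ltnW k_le) //.
by congr slerp; rewrite -!muln2 -!natr1 !natrM; field.
Qed.
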